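(* Let $\mathbf{F}\in[L^2(\mathbb{R}^2)]^2$ be supported in the bounded domain $\Omega$. Let $\tau_1\in\mathbb{C}\setminus\{0\}$, let $\mathbf{z}_0\neq\mathbf{z}_1$ be two points in $\mathbb{R}^2\setminus\overline{\Omega}$, and fix $\mathbf{q}\in\mathbb{S}$. Then $\mathbf{F}$ is uniquely determined (among sources supported in $\Omega$) by the two phaseless data sets $$\mathcal{B}_p=\{|u^\infty_{\mathbf{F}\cup\{\mathbf{z}\},p}(\hat{\mathbf{x}},\mathbf{q},\omega,\tau)|:\ \hat{\mathbf{x}}\in\mathbb{S}_{\mathbf{q}},\ \omega\in\mathbb{W},\ \tau\in\{0,\tau_1\},\ \mathbf{z}\in\{\mathbf{z}_0,\mathbf{z}_1\}\}$$ and $$\mathcal{B}_s=\{|u^\infty_{\mathbf{F}\cup\{\mathbf{z}\},s}(\hat{\mathbf{x}},\mathbf{q},\omega,\tau)|:\ \hat{\mathbf{x}}\in\mathbb{S}^\perp_{\mathbf{q}},\ \omega\in\mathbb{W},\ \tau\in\{0,\tau_1\},\ \mathbf{z}\in\{\mathbf{z}_0,\mathbf{z}_1\}\}.$$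
   Context: $\mathbb{W}=(\omega_{min},\omega_{max})$, $0<\omega_{min}<\omega_{max}$; Lamé constants $\mu>0$, $2\mu+\lambda>0$; $k_p=\omega/\sqrt{\lambda+2\mu}$, $k_s=\omega/\sqrt\mu$. $\mathbb{S}$ is the unit circle; $\hat{\mathbf{x}}^\perp$ is $\hat{\mathbf{x}}$ rotated anticlockwise by $\pi/2$. $\mathbb{S}_{\mathbf{q}}=\{\hat{\mathbf{x}}\in\mathbb{S}:\mathbf{q}\cdot\hat{\mathbf{x}}\ge 1/2\}$, $\mathbb{S}^\perp_{\mathbf{q}}=\{\hat{\mathbf{x}}\in\mathbb{S}:\mathbf{q}\cdot\hat{\mathbf{x}}^\perp\ge 1/2\}$. Source far fields: $u^\infty_{\mathbf{F},p}(\hat{\mathbf{x}},\omega)=\int_{\mathbb{R}^2}e^{-ik_p\hat{\mathbf{x}}\cdot\mathbf{y}}\hat{\mathbf{x}}\cdot\mathbf{F}(\mathbf{y})d\mathbf{y}$, $u^\infty_{\mathbf{F},s}(\hat{\mathbf{x}},\omega)=\int_{\mathbb{R}^2}e^{-ik_s\hat{\mathbf{x}}\cdot\mathbf{y}}\hat{\mathbf{x}}^\perp\cdot\mathbf{F}(\mathbf{y})d\mathbf{y}$. With an added point source at $\mathbf{z}$ of strength $\tau$ and polarization $\mathbf{q}$, the far fields are $u^\infty_{\mathbf{F}\cup\{\mathbf{z}\},p}(\hat{\mathbf{x}},\mathbf{q},\omega,\tau)=u^\infty_{\mathbf{F},p}(\hat{\mathbf{x}},\omega)+\tau e^{-ik_p\hat{\mathbf{x}}\cdot\mathbf{z}}\,\mathbf{q}\cdot\hat{\mathbf{x}}$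 and $u^\infty_{\mathbf{F}\cup\{\mathbf{z}\},s}(\hat{\mathbf{x}},\mathbf{q},\omega,\tau)=u^\infty_{\mathbf{F},s}(\hat{\mathbf{x}},\omega)+\tau e^{-ik_s\hat{\mathbf{x}}\cdot\mathbf{z}}\,\mathbf{q}\cdot\hat{\mathbf{x}}^\perp$. *)

(* Defs.v *)
From HB Require Import structures.
From mathcomp Require Import all_boot all_order all_algebra.
From mathcomp Require Import all_classical all_reals all_analysis.
From mathcomp Require Import complex.
Set Implicit Arguments. Unset Strict Implicit. Unset Printing Implicit Defensive.
Import Order.TTheory GRing.Theory Num.Theory.
Import numFieldNormedType.Exports.
Local Open Scope classical_set_scope.
Local Open Scope ring_scope.
Local Open Scope complex_scope.

Section Elastic.
Variable R : realType.

Definition pt := (R * R)%type.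

Definition leb2 := ((@lebesgue_measure R) \x (@lebesgue_measure R))%E.

Definition dot (a b : pt) : R := a.1 * b.1 + a.2 * b.2.
Definition perp (a : pt) : pt := (- a.2, a.1).
Definition unit_circle : set pt := [set x | x.1 ^+ 2 + x.2 ^+ 2 = 1].
Definition S_q (q : pt) : set pt := [set x | unit_circle x /\ dot q x >= 1/2].
Definition S_q_perp (q : pt) : set pt := [set x | unit_circle x /\ dot q (perp x) >= 1/2].

Definition cint (f : pt -> R[i]) : R[i] :=
  (Rintegral leb2 setT (fun y => complex.Re (f y)))%:C
  + 'i * (Rintegral leb2 setT (fun y => complex.Im (f y)))%:C.

Definition expmi (t : R) : R[i] := (cos t)%:C - 'i * (sin t)%:C.

Definition cdot (x : pt) (v : R[i] * R[i]) : R[i] := (x.1)%:C * v.1 + (x.2)%:C * v.2.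

Definition kp (lam mu omega : R) : R := omega / Num.sqrt (lam + 2 * mu).
Definition ks (mu omega : R) : R := omega / Num.sqrt mu.

Definition uinf_p (lam mu : R) (F : pt -> R[i] * R[i]) (x : pt) (omega : R) : R[i] :=
  cint (fun y => expmi (kp lam mu omega * dot x y) * cdot x (F y)).
Definition uinf_s (mu : R) (F : pt -> R[i] * R[i]) (x : pt) (omega : R) : R[i] :=
  cint (fun y => expmi (ks mu omega * dot x y) * cdot (perp x) (F y)).

(* far fields with an added point source at z, strength tau, polarization q *)
Definition uinf_pz (lam mu : R) (F : pt -> R[i] * R[i]) (z : pt) (x q : pt)
  (omega : R) (tau : R[i]) : R[i] :=
  uinf_p lam mu F x omega + tau * expmi (kp lam mu omega * dot x z) * (dot q x)%:C.
Definition uinf_sz (mu : R) (F : pt -> R[i] * R[i]) (z : pt) (x q : pt)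
  (omega : R) (tau : R[i]) : R[i] :=
  uinf_s mu F x omega + tau * expmi (ks mu omega * dot x z) * (dot q (perp x))%:C.

Definition L2_real (g : pt -> R) : Prop :=
  measurable_fun setT g /\ (\int[leb2]_(y in setT) ((g y) ^+ 2)%:E < +oo)%E.
Definition L2_field (F : pt -> R[i] * R[i]) : Prop :=
  [/\ L2_real (fun y => complex.Re (F y).1), L2_real (fun y => complex.Im (F y).1),
      L2_real (fun y => complex.Re (F y).2) & L2_real (fun y => complex.Im (F y).2)].

Definition supported_in (F : pt -> R[i] * R[i]) (Om : set pt) : Prop :=
  forall y, ~ Om y -> F y = (0, 0).

Definition bounded_domain (Om : set pt) : Prop :=
  [/\ open Om, Om !=set0, connected Om &
      exists M : R, forall y, Om y -> `|y.1| <= M /\ `|y.2| <= M].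

End Elastic.

(* Main.v *)
Require Import Defs.
From HB Require Import structures.
From mathcomp Require Import all_boot all_order all_algebra.
From mathcomp Require Import all_classical all_reals all_analysis.
From mathcomp Require Import complex.
From mathcomp Require Import measurable_realfun ring lra.
Import Order.TTheory GRing.Theory Num.Theory.
Import numFieldNormedType.Exports.
Local Open Scope classical_set_scope.
Local Open Scope ring_scope.
Set Implicit Arguments. Unset Strict Implicit. Unset Printing Implicit Defensive.

(** Comparing the intensities for [tau = 0] and [tau = tau1] at the two source
    positions gives two real-linear equations for the difference of the far
    fields, which are independent as soon as [sin (k x.(z0 - z1)) <> 0]; so the
    far fields of [F] and [G] agree on small intervals of wave numbers along
    every direction [x] common to the two arcs, except one.

    Write the (compactly supported) difference as a pair [(a, b)] of real and
    imaginary parts, and call a bounded function a multiplier if multiplication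
    by it preserves the vanishing of the Fourier integrals of [(a, b)] at all
    the phases of a given set. Multipliers form an algebra closed under bounded
    pointwise limits, and differentiating under the integral sign shows that
    [s] is a multiplier whenever the set of phases is open in the direction
    [s]. Along a ray, [x.y] is therefore a multiplier, hence so are
    [cos (k x.y)] and [sin (k x.y)], which extends the vanishing from an
    interval of wave numbers to all of them. Both components of the Fourier
    transform then vanish on an open cone of the plane, so that the coordinates
    are multipliers, then the indicators of half-planes, as limits of
    polynomials, and finally the indicators of all Borel sets. Hence the
    difference is zero almost everywhere. *)

(** * Elementary estimates for sine, cosine and small parameters *)

Lemma normr_sin_le (R : realType) (u : R) : `|sin u| <= `|u|.
Proof.
wlog u0 : u / 0 <= u.
  move=> H; case: (leP 0 u) => [/H//|u0].
  by rewrite -normrN -sinN -[leRHS]normrN; apply: H; rewrite oppr_ge0 ltW.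
have [c _] := MVT_segment u0 (fun x _ => is_derive_sin x)
  (continuous_subspaceT (@continuous_sin R)).
rewrite sin0 !subr0 => ->; rewrite normrM ler_piMl//.
exact: cos_max.
Qed.

Lemma cos_quadratic_approx (R : realType) (u : R) : `|cos u - 1| <= u ^+ 2.
Proof.
wlog u0 : u / 0 <= u.
  move=> H; case: (leP 0 u) => [/H//|u0].
  by rewrite -cosN -sqrrN; apply: H; rewrite oppr_ge0 ltW.
have [c] := MVT_segment u0 (fun x _ => is_derive_cos x)
  (continuous_subspaceT (@continuous_cos R)).
rewrite in_itv/= => /andP[c0 cu].
rewrite cos0 subr0 => ->; rewrite normrM normrN expr2 (ger0_norm u0) ler_wpM2r//.
by rewrite (le_trans (normr_sin_le _))// ger0_norm.
Qed.

Lemma sin_quadratic_approx (R : realType) (u : R) : `|sin u - u| <= 2 * u ^+ 2.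
Proof.
wlog u0 : u / 0 <= u.
  move=> H; case: (leP 0 u) => [/H//|u0].
  have := H (- u); rewrite sinN -opprD normrN sqrrN; apply.
  by rewrite oppr_ge0 ltW.
have [c] := MVT_segment u0 (fun x _ => is_derive_sin x)
  (continuous_subspaceT (@continuous_sin R)).
rewrite in_itv/= => /andP[c0 cu].
rewrite sin0 !subr0 => ->; rewrite -[X in _ * u - X]mul1r -mulrBl normrM.
rewrite (ger0_norm u0) expr2 mulrA ler_wpM2r//.
(* For [c >= 1], [|cos c - 1| <= 2 <= 2 * u]; for [c < 1], the quadratic bound gives
   [c ^+ 2 <= c <= u]. *)
have [c1|c1] := leP 1 c.
  rewrite (le_trans (ler_normB _ _))// normr1.
  by have := cos_max c; have := le_trans c1 cu; lra.
rewrite (le_trans (cos_quadratic_approx _))// expr2 (le_trans (ler_piMr c0 (ltW c1)))//; lra.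
Qed.

(** Serves to conclude that a derivative vanishes, once its second-order remainder has been divided
    by [t]. *)
Lemma norm_le_linear_eq0 (R : realType) (x K e : R) : 0 < e ->
  (forall t, 0 < t < e -> `|x| <= t * K) -> x = 0.
Proof.
move=> e0 H; apply/eqP; rewrite -normr_eq0 eq_le normr_ge0 andbT.
apply/ler_addgt0Pr => r r0; rewrite add0r.
pose K' := `|K| + 1; have K0 : 0 < K' by rewrite ltr_wpDl.
pose t := Num.min (e / 2) (r / K').
have t0 : 0 < t by rewrite lt_min !divr_gt0.
apply: (le_trans (H t _)).
  by rewrite t0/= gt_min; apply/orP; left; lra.
apply: (@le_trans _ _ (t * K')).
  by rewrite ler_wpM2l ?(ltW t0)// (le_trans (ler_norm _))// lerDl.
by rewrite -ler_pdivlMr// ge_min lexx orbT.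
Qed.

(** * Bernoulli inequalities and polynomial approximation of a step *)

Lemma onemX_bernoulli_ge (R : realType) (t : R) N : 0 <= t <= 1 ->
  1 - N%:R * t <= (1 - t) ^+ N.
Proof.
move=> /andP[t0 t1]; elim: N => [|N IH]; first by rewrite mul0r subr0 expr0.
rewrite exprS; apply: (@le_trans _ _ ((1 - t) * (1 - N%:R * t))).
  have : 0 <= N%:R * t ^+ 2 by rewrite mulr_ge0// sqr_ge0.
  by rewrite -natr1; nra.
by rewrite ler_wpM2l// subr_ge0.
Qed.

(** Induction on [(1 - t)(1 + (N + 1) t) = 1 + N t - (N + 1) t^2 <= 1 + N t]. *)
Lemma onemX_bernoulli_le (R : realType) (t : R) N : 0 <= t <= 1 ->
  (1 - t) ^+ N * (1 + N%:R * t) <= 1.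
Proof.
move=> /andP[t0 t1]; elim: N => [|N IH]; first by rewrite mul0r addr0 expr0 mulr1.
apply: le_trans IH; rewrite exprSr -mulrA ler_wpM2l ?exprn_ge0 ?subr_ge0//.
have : 0 <= N%:R * t ^+ 2 by rewrite mulr_ge0// sqr_ge0.
by have := sqr_ge0 t; rewrite -natr1; nra.
Qed.

(* Polynomials converging on [0, 1] to the indicator of [x < 1/2]. The factor [n]
   in the exponent makes the limit vanish at [1/2] too; with exponent [4 ^ n]
   alone the value there would be [exp (- 1)]. *)
Definition step_seq (R : realType) n : {poly R} :=
  (1 - 'X ^+ (n + n)) ^+ (n * 4 ^ n).

Lemma step_seq_itv (R : realType) n (x : R) : 0 <= x <= 1 ->
  0 <= (step_seq R n).[x] <= 1.
Proof.
move=> /andP[x0 x1]; rewrite /step_seq !hornerE.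
have h0 : 0 <= x ^+ (n + n) by exact: exprn_ge0.
have h1 : x ^+ (n + n) <= 1 by exact: exprn_ile1.
by rewrite exprn_ge0 ?subr_ge0//= exprn_ile1// ?subr_ge0// lerBlDr lerDl.
Qed.

Lemma step_exponentE (R : realType) n (x : R) :
  (n * 4 ^ n)%:R * x ^+ (n + n) = n%:R * (2 * x) ^+ n * (2 * x) ^+ n.
Proof.
rewrite natrM natrX exprD -mulrA -mulrA; congr (_ * _).
rewrite !exprMn (_ : 4 = 2 * 2 :> R) ?exprMn; first ring.
by ring.
Qed.

(** Apply Bernoulli with [t = x^(2n)] and [N = n 4^n], so that [N t = n (2x)^(2n)]. If [2x < 1] this
    tends to 0 and the lower bound [1 - N t] forces the limit 1; if [2x >= 1] it is at least [n],
    and the upper bound [1 / (1 + N t)] is at most the harmonic sequence. *)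
Lemma step_seq_cvg (R : realType) (x : R) : 0 <= x <= 1 ->
  (fun n => (step_seq R n).[x]) @ \oo --> (if x < 2^-1 then 1 else 0 : R).
Proof.
move=> x01; have /andP[x0 x1] := x01.
have h n : 0 <= x ^+ (n + n) <= 1 by rewrite exprn_ge0//= exprn_ile1.
case: ltP => hx.
  pose r := 2 * x; have r0 : 0 <= r by rewrite mulr_ge0.
  have r1 : r < 1 by rewrite /r; lra.
  (* Bernoulli at [1 - r] gives [r^n (1 + n (1 - r)) <= 1]. One factor [r^n] of [n r^n r^n] thus
     absorbs [n], and the other tends to 0. *)
  have nr n : n%:R * r ^+ n <= (1 - r)^-1.
    rewrite -[leRHS]mul1r ler_pdivlMr ?subr_gt0//.
    have b : 0 <= 1 - r <= 1 by lra.
    have := onemX_bernoulli_le n b; rewrite subKr.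
    by have := exprn_ge0 n r0; lra.
  apply: (@squeeze_cvgr _ _ _ _ (fun n => 1 - (1 - r)^-1 * r ^+ n) (fun=> 1)).
  - apply: nearW => n; have /andP[_ ->] := step_seq_itv n x01; rewrite andbT.
    rewrite /step_seq !hornerE; apply: le_trans (onemX_bernoulli_ge _ (h n)).
    rewrite lerD2l lerN2 step_exponentE ler_wpM2r//.
    exact: exprn_ge0.
  - rewrite -[X in _ --> X]subr0 -(mulr0 (1 - r)^-1); apply: cvgB; first exact: cvg_cst.
    by apply: cvgMr; apply: cvg_expr; rewrite ger0_norm.
  - exact: cvg_cst.
apply: (@squeeze_cvgr _ _ _ _ (fun=> 0) (@harmonic R)).
- apply: nearW => n; have /andP[-> _] := step_seq_itv n x01 => /=.
  rewrite /step_seq !hornerE -[leRHS]mul1r ler_pdivlMr//.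
  apply: le_trans (onemX_bernoulli_le (n * 4 ^ n) (h n)).
  rewrite ler_wpM2l//; first by rewrite exprn_ge0// subr_ge0; have /andP[] := h n.
  rewrite -natr1 addrC lerD2l step_exponentE -mulrA -exprD ler_peMr// exprn_ege1//.
  lra.
- exact: cvg_cst.
- exact: cvg_harmonic.
Qed.

(** * The algebra of multipliers *)

Section Multipliers.
Context d (T : measurableType d) (R : realType).
Variables (mu : {measure set T -> \bar R}) (B : set T).
Implicit Types (a b f s phi : T -> R) (Ph : set (T -> R)).

Local Notation I := (Rintegral mu setT).

Definition integ a := mu.-integrable setT (EFin \o a).

(** Vanishing off [B] lets a multiplier be bounded on [B] only, as linear functions are when [B] is
    bounded. *)
Definition adm a := integ a /\ forall y, ~ B y -> a y = 0.

(** The real part of [e^(-i phi) (a + i b)]. Its imaginary part is [osc phi b (\- a)], so the two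
    equations in [orth] say that the complex integral is zero. *)
Definition osc phi a b := fun y => cos (phi y) * a y + sin (phi y) * b y.

Definition orth Ph a b := [/\ adm a, adm b & forall phi, Ph phi ->
  I (osc phi a b) = 0 /\
  I (osc phi b (\- a)) = 0].

Definition bounded_on f := exists C, forall y, B y -> `|f y| <= C.

Definition multiplier Ph f := [/\ measurable_fun setT f, bounded_on f &
  forall a b, orth Ph a b -> orth Ph (f \* a) (f \* b)].

Lemma integ_measurable a : integ a -> measurable_fun setT a.
Proof. by move/measurable_int/measurable_EFinP. Qed.

Lemma integD a b : integ a -> integ b -> integ (a \+ b).
Proof. by move=> ia ib; exact: (integrableD measurableT ia ib). Qed.

Lemma integN a : integ a -> integ (\- a).
Proof. by move=> ia; exact: (integrableN ia). Qed.

Lemma integZ (k : R) a : integ a -> integ (fun y => k * a y).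
Proof. by move=> ia; exact: (integrableZl measurableT k ia). Qed.

Lemma le_integ a b : measurable_fun setT a -> (forall y, `|a y| <= `|b y|) ->
  integ b -> integ a.
Proof.
move=> ma ab ib; apply: (le_integrable _ _ _ ib) => //; first exact/measurable_EFinP.
by move=> y _; rewrite /= lee_fin.
Qed.

Lemma admD a b : adm a -> adm b -> adm (a \+ b).
Proof.
move=> [ia a0] [ib b0]; split; first exact: integD.
by move=> y By /=; rewrite a0// b0// addr0.
Qed.

Lemma admN a : adm a -> adm (\- a).
Proof.
move=> [ia a0]; split; first exact: integN.
by move=> y By /=; rewrite a0// oppr0.
Qed.

Lemma admM f a : measurable_fun setT f -> bounded_on f -> adm a -> adm (f \* a).
Proof.
move=> mf [C fC] [ia a0]; split; last by move=> y By /=; rewrite a0// mulr0.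
apply: (@le_integ _ (fun y => C * a y)); last exact: integZ.
  by apply: measurable_funM => //; exact: integ_measurable.
move=> y /=; rewrite !normrM; have [By|By] := pselect (B y).
  by rewrite ler_wpM2r// (le_trans (fC _ By))// ler_norm.
by rewrite a0// normr0 !mulr0.
Qed.

Lemma adm_osc phi a b : measurable_fun setT phi -> adm a -> adm b ->
  adm (osc phi a b).
Proof.
move=> mphi aa ab; apply: admD; apply: admM => //.
- by apply: measurableT_comp => //; apply: continuous_measurable_fun; exact: continuous_cos.
- by exists 1 => y _; exact: cos_max.
- by apply: measurableT_comp => //; apply: continuous_measurable_fun; exact: continuous_sin.
- by exists 1 => y _; exact: sin_max.
Qed.

Lemma integ_osc phi a b : measurable_fun setT phi -> adm a -> adm b ->
  integ (osc phi a b).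
Proof. by move=> mphi aa ab; have [] := adm_osc mphi aa ab. Qed.

Lemma oscM phi f a b : osc phi (f \* a) (f \* b) = f \* osc phi a b.
Proof. by apply/funext => y; rewrite /osc/=; ring. Qed.

Lemma oscMN phi f a b : osc phi (f \* b) (\- (f \* a)) = f \* osc phi b (\- a).
Proof. by apply/funext => y; rewrite /osc/=; ring. Qed.

Lemma multiplierD Ph f g : (forall phi, Ph phi -> measurable_fun setT phi) ->
  multiplier Ph f -> multiplier Ph g -> multiplier Ph (f \+ g).
Proof.
move=> mPh [mf [C fC] Mf] [mg [D gD] Mg]; split.
- exact: measurable_funD.
- by exists (C + D) => y By; rewrite (le_trans (ler_normD _ _))// lerD ?fC ?gD.
- move=> a b o; have [afa afb of_] := Mf _ _ o; have [aga agb og] := Mg _ _ o.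
  have Ef c : (f \+ g) \* c = (f \* c) \+ (g \* c).
    by apply/funext => y /=; rewrite mulrDl.
  split; rewrite ?Ef; [exact: admD..|] => phi Pphi.
  have [f1 f2] := of_ _ Pphi; have [g1 g2] := og _ Pphi; have mphi := mPh _ Pphi.
  split.
    rewrite (_ : osc _ _ _ = osc phi (f \* a) (f \* b) \+ osc phi (g \* a) (g \* b)).
      by rewrite RintegralD ?f1 ?g1 ?addr0//; apply: integ_osc.
    by apply/funext => y; rewrite /osc/=; ring.
  rewrite (_ : osc _ _ _ = osc phi (f \* b) (\- (f \* a)) \+ osc phi (g \* b) (\- (g \* a))).
    by rewrite RintegralD ?f2 ?g2 ?addr0//; apply: integ_osc => //; exact: admN.
  by apply/funext => y; rewrite /osc/=; ring.
Qed.

Lemma multiplier_cst Ph (k : R) : (forall phi, Ph phi -> measurable_fun setT phi) ->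
  multiplier Ph (fun=> k).
Proof.
move=> mPh; split => //; first by exists `|k|.
move=> a b [aa ab H]; split; [by apply: admM => //; exists `|k| ..|] => phi Pphi.
have [H1 H2] := H _ Pphi; have mphi := mPh _ Pphi; rewrite oscM oscMN; split.
  by rewrite RintegralZl ?H1 ?mulr0//; apply: integ_osc.
by rewrite RintegralZl ?H2 ?mulr0//; apply: integ_osc => //; exact: admN.
Qed.

Lemma multiplierM Ph f g : multiplier Ph f -> multiplier Ph g ->
  multiplier Ph (f \* g).
Proof.
move=> [mf [C fC] Mf] [mg [D gD] Mg]; split.
- exact: measurable_funM.
- by exists (C * D) => y By; rewrite normrM ler_pM// ?fC ?gD.
- move=> a b /Mg /Mf; congr (orth _ _ _); by apply/funext => y /=; rewrite mulrA.
Qed.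

(** * Bounded limits and differentiation under the integral sign *)

Lemma Rintegral_dominated_cvg (f_ : nat -> T -> R) f g :
  (forall n, measurable_fun setT (f_ n)) -> integ g ->
  (forall n y, `|f_ n y| <= g y) -> (forall y, f_ ^~ y @ \oo --> f y) ->
  (fun n => I (f_ n)) @ \oo --> I f.
Proof.
move=> mf ig fg ff.
have mf' : measurable_fun setT f.
  by apply: (measurable_fun_cvg mf) => y _; exact: ff.
have fgl y : `|f y| <= g y.
  have c : `|f_ n y| @[n --> \oo] --> `|f y| by apply: cvg_norm; exact: ff.
  rewrite -(cvg_lim (@Rhausdorff R) c); apply: limr_le; first by apply: cvgP c.
  by apply: nearW => n; exact: fg.
have intf : integ f.
  by apply: le_integ ig => // y; rewrite (le_trans (fgl y))// ler_norm.
apply: fine_cvg; rewrite fineK; last exact: integrable_fin_num.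
apply: (@dominated_cvg _ _ _ mu setT measurableT _ _ (EFin \o g)) => //.
- by move=> n; exact/measurable_EFinP.
- by move=> y _; apply: cvg_EFin; [exact: nearW|exact: ff].
- by move=> n y _; rewrite lee_fin.
Qed.

(** Dominated convergence with majorant [|C| |g|]; off [B] the factor [g] is zero, so bounds and
    convergence are required on [B] only. *)
Lemma multiplier_cvg Ph (f_ : nat -> T -> R) f (C : R) :
  (forall phi, Ph phi -> measurable_fun setT phi) ->
  (forall n, multiplier Ph (f_ n)) -> measurable_fun setT f ->
  (forall n y, B y -> `|f_ n y| <= C) ->
  (forall y, B y -> f_ ^~ y @ \oo --> f y) -> multiplier Ph f.
Proof.
move=> mPh Mf mf fC ff.
have bf : bounded_on f.
  exists C => y By; have c : `|f_ n y| @[n --> \oo] --> `|f y| by apply: cvg_norm; exact: ff.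
  rewrite -(cvg_lim (@Rhausdorff R) c); apply: limr_le; first by apply: cvgP c.
  by apply: nearW => n; exact: fC.
have key g : adm g -> (forall n, I (f_ n \* g) = 0) ->
    I (f \* g) = 0.
  move=> [ig g0] I0.
  have h : (fun n => I (f_ n \* g)) @ \oo -->
      I (f \* g).
    apply: (@Rintegral_dominated_cvg _ _ (fun y => `|C| * `|g y|)).
    - move=> n; apply: measurable_funM; first by case: (Mf n).
      exact: integ_measurable.
    - by apply: integZ; exact: integrable_norm.
    - move=> n y /=; have [By|By] := pselect (B y).
        by rewrite normrM ler_wpM2r// (le_trans (fC n y By))// ler_norm.
      by rewrite g0// mulr0 normr0 mulr0.
    - move=> y /=; have [By|By] := pselect (B y).
        by apply: cvgMl; exact: ff.
      rewrite g0//= mulr0; under eq_fun do rewrite mulr0; exact: cvg_cst.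
  rewrite -(cvg_lim (@Rhausdorff R) h).
  by apply/cvg_lim => //; under eq_fun do rewrite I0; exact: cvg_cst.
split => // a b oab; have [aa ab _] := oab.
split; [exact: admM..|] => phi Pphi; have mphi := mPh _ Pphi.
rewrite oscM oscMN; split; apply: key.
- exact: adm_osc.
- by move=> n; have [_ _ /(_ _ _ oab)[_ _ /(_ _ Pphi)[]]] := Mf n; rewrite oscM.
- by apply: adm_osc => //; exact: admN.
- by move=> n; have [_ _ /(_ _ _ oab)[_ _ /(_ _ Pphi)[]]] := Mf n; rewrite oscMN.
Qed.

(* The derivative of [osc (phi + t s) a b] at [t = 0] is [s * osc phi b (- a)]. *)
Lemma Rintegral_osc_derive phi s a b (e : R) :
  measurable_fun setT phi -> measurable_fun setT s -> bounded_on s ->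
  adm a -> adm b -> 0 < e ->
  (forall t, `|t| < e -> I (osc (fun y => phi y + t * s y) a b) = 0) ->
  I (s \* osc phi b (\- a)) = 0.
Proof.
move=> mphi ms bs aa ab e0 H.
pose c := osc phi a b; pose D := osc phi b (\- a).
have aD : adm D by apply: adm_osc => //; exact: admN.
have ac : adm c by exact: adm_osc.
have asD : adm (s \* D) by exact: admM.
have Ic : I c = 0.
  rewrite -(H 0) ?normr0//; congr (Rintegral _ _ _); apply/funext => y.
  by rewrite /c /osc mul0r addr0.
have [C sC] := bs.
pose m y := 2 * C ^+ 2 * (`|c y| + `|D y|).
have im : integ m.
  by apply: integZ; apply: integD; apply: integrable_norm; [case: ac|case: aD].
apply: (@norm_le_linear_eq0 _ _ (I m) e e0) => t /andP[t0 te].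
have mt : measurable_fun setT (fun y => phi y + t * s y).
  by apply: measurable_funD => //; apply: measurable_funM.
have ao := adm_osc mt aa ab.
have itsD : integ (fun y => t * (s \* D) y) by apply: integZ; case: asD.
(* The first-order Taylor remainder. As the integrals of [c] and of the shifted [osc] vanish,
   [I r = t * I (s \* D)], whereas [|r| <= t ^+ 2 * m]; dividing by [t] leaves a bound linear in
   [t]. *)
pose r y := t * (s \* D) y - (osc (fun y => phi y + t * s y) a b y - c y).
have ioc : integ (fun y => osc (fun y => phi y + t * s y) a b y - c y).
  by apply: integD; [case: ao|apply: integN; case: ac].
have ir : integ r by apply: integD => //; exact: integN.
have rE : I r = t * I (s \* D).
  rewrite /r RintegralB// RintegralZl//; last by case: asD.
  rewrite RintegralB//; [|by case: ao|by case: ac].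
  by rewrite Ic H ?subr0 ?gtr0_norm// subr0.
have rm y : `|r y| <= t ^+ 2 * m y.
  have [By|By] := pselect (B y); last first.
    rewrite /r /m (aD.2 _ By) (ac.2 _ By) (ao.2 _ By) /= (aD.2 _ By).
    by rewrite !mulr0 !subr0 normr0 addr0 !mulr0.
  have -> : r y = (1 - cos (t * s y)) * c y + (t * s y - sin (t * s y)) * D y.
    by rewrite /r/= /c /D /osc/= cosD sinD; ring.
  rewrite (le_trans (ler_normD _ _))// !normrM.
  have sq : (t * s y) ^+ 2 <= t ^+ 2 * C ^+ 2.
    rewrite exprMn ler_wpM2l ?sqr_ge0//.
    rewrite -[s y ^+ 2]real_normK ?num_real// lerXn2r ?nnegrE ?sC//.
    exact: le_trans (sC _ By).
  have h1 : `|1 - cos (t * s y)| <= 2 * (t ^+ 2 * C ^+ 2).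
    rewrite distrC (le_trans (cos_quadratic_approx _))//.
    by have := sqr_ge0 (t * s y); lra.
  have h2 : `|t * s y - sin (t * s y)| <= 2 * (t ^+ 2 * C ^+ 2).
    by rewrite distrC (le_trans (sin_quadratic_approx _))//; lra.
  have -> : t ^+ 2 * m y = 2 * (t ^+ 2 * C ^+ 2) * `|c y| + 2 * (t ^+ 2 * C ^+ 2) * `|D y|.
    by rewrite /m; ring.
  by rewrite lerD// ler_wpM2r.
have : `|I r| <= t ^+ 2 * I m.
  rewrite (le_trans (le_normr_Rintegral _ _))// -RintegralZl//.
  apply: le_Rintegral => //;
    [exact: integrable_norm|exact: integZ|by move=> y _; exact: rm].
by rewrite rE normrM (gtr0_norm t0) expr2 -mulrA ler_pM2l.
Qed.

(** The integrals vanish along [phi + t s] for small [t], hence so do their derivatives at [t = 0],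
    in which the factor [s] appears. *)
Lemma multiplier_dir Ph s : (forall phi, Ph phi -> measurable_fun setT phi) ->
  measurable_fun setT s -> bounded_on s ->
  (forall phi, Ph phi -> exists2 e, 0 < e &
     forall t, `|t| < e -> Ph (fun y => phi y + t * s y)) ->
  multiplier Ph s.
Proof.
move=> mPh ms bs dirs; split => // a b [aa ab H]; split; [exact: admM..|].
move=> phi Pphi; have [e e0 He] := dirs _ Pphi; have mphi := mPh _ Pphi.
rewrite oscM oscMN; split; last first.
  by apply: (Rintegral_osc_derive (e := e)) => // t /He /H[].
(* The same derivative for the pair [(b, - a)], that is for [- i (a + i b)]. *)
have : I (s \* osc phi (\- a) (\- b)) = 0.
  by apply: (Rintegral_osc_derive (e := e)) => //;[exact: admN|move=> t /He /H[]].
rewrite (_ : _ \* _ = fun y => -1 * (s \* osc phi a b) y); last first.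
  by apply/funext => y; rewrite /osc/=; ring.
rewrite RintegralZl//; first by move/eqP; rewrite mulf_eq0 oppr_eq0 oner_eq0 => /eqP.
by have [] : adm (s \* osc phi a b) by apply: admM => //; exact: adm_osc.
Qed.

Lemma multiplier_horner Ph s (p : {poly R}) :
  (forall phi, Ph phi -> measurable_fun setT phi) ->
  multiplier Ph s -> multiplier Ph (fun y => p.[s y]).
Proof.
move=> mPh Ms; elim/poly_ind: p => [|p c IH].
  by under eq_fun do rewrite horner0; exact: multiplier_cst.
under eq_fun do rewrite hornerMXaddC.
apply: (@multiplierD _ (fun y => p.[s y] * s y) (fun=> c)) => //.
  exact: multiplierM.
exact: multiplier_cst.
Qed.

(** The factorial bound on the coefficients dominates all partial sums on [B] by the exponential
    series at [C], which gives the uniform bound for a limit of polynomials in [s]. *)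
Lemma multiplier_pseries Ph s (u : nat -> R) (g : R -> R) :
  (forall phi, Ph phi -> measurable_fun setT phi) -> multiplier Ph s ->
  (forall n, `|u n| <= n`!%:R^-1) -> (forall x, pseries u x @ \oo --> g x) ->
  measurable_fun setT g -> multiplier Ph (g \o s).
Proof.
move=> mPh Ms uf ug mg; have [ms [C sC] _] := Ms.
have C0 y : B y -> 0 <= C by move=> /sC; exact: le_trans.
apply: (@multiplier_cvg _ (fun n y => (\poly_(i < n) u i).[s y]) _
  (limn (series (exp_coeff C)))) => //.
- by move=> n; exact: multiplier_horner.
- exact: measurableT_comp.
- move=> n y By; apply: (@le_trans _ _ (series (exp_coeff C) n)).
    rewrite horner_poly /series/= big_mkord (le_trans (ler_norm_sum _ _ _))//.
    apply: ler_sum => i _; rewrite normrM normrX /exp_coeff/= mulrC ler_pM//.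
    by rewrite lerXn2r ?nnegrE ?(C0 y)// sC.
  apply: nondecreasing_cvgn_le; last exact: is_cvg_series_exp_coeff.
  by apply: nondecreasing_series => i _ _; apply: exp_coeff_ge0; exact: C0 By.
- move=> y By; have := ug (s y); rewrite /pseries/series/=.
  apply: cvg_trans; apply: near_eq_cvg; apply: nearW => n.
  by rewrite horner_poly big_mkord.
Qed.

Lemma multiplier_cos Ph s : (forall phi, Ph phi -> measurable_fun setT phi) ->
  multiplier Ph s -> multiplier Ph (cos \o s).
Proof.
move=> mPh Ms; apply: (multiplier_pseries mPh Ms); last 2 first.
- move=> x; rewrite cosE; have := @is_cvg_series_cos_coeff R x.
  rewrite cos_coeffE; exact.
- by apply: continuous_measurable_fun; exact: continuous_cos.
- move=> n /=; rewrite !normrM normrX normrN1 expr1n mulr1 normfV normr_nat.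
  by rewrite normr_nat ler_piMl//; case: odd.
Qed.

Lemma multiplier_sin Ph s : (forall phi, Ph phi -> measurable_fun setT phi) ->
  multiplier Ph s -> multiplier Ph (sin \o s).
Proof.
move=> mPh Ms; apply: (multiplier_pseries mPh Ms); last 2 first.
- move=> x; rewrite sinE; have := @is_cvg_series_sin_coeff R x.
  rewrite sin_coeffE; exact.
- by apply: continuous_measurable_fun; exact: continuous_sin.
- move=> n /=; rewrite !normrM normrX normrN1 expr1n mulr1 normfV normr_nat.
  by rewrite normr_nat ler_piMl//; case: odd.
Qed.

(** * Indicators as multipliers and almost everywhere vanishing *)

Lemma multiplier_ray Ph s (c : R) :
  (forall phi, Ph phi -> measurable_fun setT phi) -> multiplier Ph s ->
  multiplier Ph \1_[set y | s y < c].
Proof.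
move=> mPh Ms; have [ms [C sC] _] := Ms.
(* [M] bounds [|s - c|] on [B], the 1 making it positive. The affine map [x'] then sends the values
   of [s] on [B] into [[0, 1]] and the threshold [c] to [1/2], where [step_seq] jumps. *)
pose M := `|C| + `|c| + 1; have M0 : 0 < M.
  by rewrite /M ltr_wpDl// addr_ge0.
pose x' y := M^-1 / 2 * (s y - c) + 2^-1.
have Mx : multiplier Ph x'.
  have := @multiplier_horner Ph s ((M^-1 / 2) *: ('X - c%:P) + (2^-1)%:P) mPh Ms.
  by congr multiplier; apply/funext => y; rewrite !hornerE.
have x01 y : B y -> 0 <= x' y <= 1.
  move=> /sC; rewrite ler_norml => /andP[h1 h2].
  have : `|M^-1 * (s y - c)| <= 1.
    rewrite normrM gtr0_norm ?invr_gt0// ler_pdivrMl// mulr1 ler_norml /M.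
    have := ler_norm C; have := ler_norm c; have := ler_norm (- c); rewrite normrN.
    by lra.
  have -> : x' y = M^-1 * (s y - c) / 2 + 2^-1 by rewrite /x'; ring.
  by rewrite ler_norml; move: (M^-1 * _) => z; lra.
apply: (@multiplier_cvg _ (fun n y => (step_seq R n).[x' y]) _ 1) => //.
- by move=> n; exact: multiplier_horner.
- apply: measurable_indic; rewrite -[X in measurable X]setTI.
  rewrite (_ : [set y | s y < c] = s @^-1` `]-oo, c[); first exact: ms.
  by apply/seteqP; split => y /=; rewrite in_itv.
- move=> n y /x01 /(step_seq_itv n)/andP[h0 h1]; by rewrite ger0_norm.
- move=> y /x01 /step_seq_cvg.
  have -> : (x' y < 2^-1) = (s y < c).
    rewrite /x' -[X in _ < X]add0r ltrD2r pmulr_rlt0 ?subr_lt0//.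
    by rewrite divr_gt0 ?invr_gt0.
  have -> // : (if s y < c then 1 else 0) = \1_[set y | s y < c] y :> R.
  rewrite indicE; case: ifPn => h; first by rewrite mem_set.
  by rewrite memNset //=; exact/negP.
Qed.

(** Complements come from [1 - \1_E], intersections from products, and finite unions from these by
    De Morgan. For a countable union, the indicators of the partial unions are bounded by 1 and
    eventually constant at each point. *)
Lemma multiplier_sigma_algebra Ph :
  (forall phi, Ph phi -> measurable_fun setT phi) ->
  sigma_algebra setT [set E | measurable E /\ multiplier Ph \1_E].
Proof.
move=> mPh.
have M1 : multiplier Ph (fun=> 1) by exact: multiplier_cst.
have MN1 : multiplier Ph (fun=> -1) by exact: multiplier_cst.
have setCM E : measurable E /\ multiplier Ph \1_E ->
    measurable (~` E) /\ multiplier Ph \1_(~` E).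
  move=> [mE ME]; split; first exact: measurableC.
  have := multiplierD mPh M1 (multiplierM MN1 ME).
  congr multiplier; apply/funext => y /=; rewrite !indicE in_setC.
  by case: (y \in E) => /=; ring.
have setIM E F : measurable E /\ multiplier Ph \1_E ->
    measurable F /\ multiplier Ph \1_F ->
    measurable (E `&` F) /\ multiplier Ph \1_(E `&` F).
  move=> [mE ME] [mF MF]; split; first exact: measurableI.
  have := multiplierM ME MF.
  congr multiplier; apply/funext => y /=; rewrite !indicE in_setI.
  by case: (y \in E); case: (y \in F) => /=; ring.
have set0M : measurable (set0 : set T) /\ multiplier Ph \1_set0.
  by split => //; rewrite indic0; exact: multiplier_cst.
split => //.
  by move=> E; rewrite setTD; exact: setCM.
move=> A mA; split; first by apply: bigcupT_measurable => n; case: (mA n).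
apply: (@multiplier_cvg _ (fun n => \1_(\big[setU/set0]_(i < n) A i)) _ 1) => //.
- move=> n; suff : measurable (\big[setU/set0]_(i < n) A i) /\
    multiplier Ph \1_(\big[setU/set0]_(i < n) A i) by case.
  elim: n => [|n IH]; first by rewrite big_ord0.
  rewrite big_ord_recr/= -[_ `|` _]setCK setCU; apply: (setCM).
  by apply: (setIM); apply: (setCM) => //; exact: (mA n).
- by apply: measurable_indic; apply: bigcupT_measurable => n; case: (mA n).
- by move=> n y _; rewrite indicE; case: (y \in _); rewrite ?normr1 ?normr0.
- move=> y _; apply: cvg_near_cst.
  have [[k _ Ak]|nA] := pselect ((\bigcup_n A n) y).
    exists k.+1 => // n /= kn; rewrite !indicE !mem_set//.
      by exists k.
    by rewrite -bigcup_mkord; exists k.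
  apply: nearW => n; rewrite !indicE !memNset// -bigcup_mkord => -[k _ Ak].
  by apply: nA; exists k.
Qed.

(** With all indicators as multipliers, [e^(-i phi) (a + i b)] has integral zero over every
    measurable set, so it vanishes almost everywhere; rotating back by [e^(i phi)] gives [a] and
    [b]. *)
Lemma orth_ae_eq0 Ph phi a b : Ph phi -> measurable_fun setT phi ->
  (forall E, measurable E -> multiplier Ph \1_E) -> orth Ph a b ->
  {ae mu, forall y, a y = 0 /\ b y = 0}.
Proof.
move=> Pphi mphi ME oab; have [aa ab _] := oab.
have key c : adm c -> (forall E, measurable E -> I (\1_E \* c) = 0) ->
    ae_eq mu setT (EFin \o c) (cst 0%E).
  move=> [ic c0] H; apply: integral_ae_eq => // E _ mE.
  rewrite integral_cst// mul0e integral_mkcond.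
  rewrite (_ : (_ \_ _) = EFin \o (\1_E \* c)); last first.
    apply/funext => y; rewrite /patch /= indicE.
    by case: ifP => _; rewrite ?mul1r ?mul0r.
  have := H _ mE; rewrite /Rintegral => h; rewrite -[LHS]fineK ?h//.
  apply: integrable_fin_num => //.
  have [] // : adm (\1_E \* c).
  apply: admM => //; exists 1 => y _; rewrite indicE.
  by case: (y \in _); rewrite ?normr1 ?normr0.
have h1 := key _ (adm_osc mphi aa ab).
have h2 := key _ (adm_osc mphi ab (admN aa)).
have e1 : ae_eq mu setT (EFin \o osc phi a b) (cst 0%E).
  apply: h1 => E mE; rewrite -oscM.
  by have [_ _ /(_ _ _ oab)[_ _ /(_ _ Pphi)[]]] := ME _ mE.
have e2 : ae_eq mu setT (EFin \o osc phi b (\- a)) (cst 0%E).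
  apply: h2 => E mE; rewrite -oscMN.
  by have [_ _ /(_ _ _ oab)[_ _ /(_ _ Pphi)[]]] := ME _ mE.
apply: (filterS2 _ _ e1 e2) => y /(_ Logic.I) /= [h3] /(_ Logic.I) [h4].
have cs := cos2Dsin2 (phi y).
split.
  have -> : a y = cos (phi y) * osc phi a b y - sin (phi y) * osc phi b (\- a) y.
    rewrite /osc/= -[LHS]mul1r -cs; ring.
  by rewrite h3 h4 !mulr0 subr0.
have -> : b y = sin (phi y) * osc phi a b y + cos (phi y) * osc phi b (\- a) y.
  rewrite /osc/= -[LHS]mul1r -cs; ring.
by rewrite h3 h4 !mulr0 addr0.
Qed.

(** The sets [A] with this property form a sigma-algebra containing the open left rays, which
    generate the Borel sets. *)
Lemma multiplier_preimage Ph s (A : set R) :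
  (forall phi, Ph phi -> measurable_fun setT phi) -> multiplier Ph s ->
  measurable A -> multiplier Ph \1_(s @^-1` A).
Proof.
move=> mPh Ms; have [ms _ _] := Ms.
have [S0 SC SU] := multiplier_sigma_algebra mPh.
pose S := [set A : set R | [set E | measurable E /\ multiplier Ph \1_E] (s @^-1` A)].
suff mS : measurable `<=` S by move=> /mS[].
have -> : @measurable _ R = (@measurable_realfun.RGenInftyO.G R).-sigma.-measurable.
  exact: measurable_realfun.RGenInftyO.measurableE.
apply: smallest_sub.
  split; rewrite /S.
  - by rewrite /= preimage_set0.
  - by move=> E /SC; rewrite !setTD.
  - by move=> E ES; have := SU _ ES; rewrite /= preimage_bigcup.
move=> _ [c ->]; rewrite /S/= (_ : _ @^-1` _ = [set y | s y < c]).
  split; last exact: multiplier_ray.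
  rewrite -[X in measurable X]setTI (_ : [set y | s y < c] = s @^-1` `]-oo, c[).
    exact: ms.
  by apply/seteqP; split => y /=; rewrite in_itv.
by apply/seteqP; split => y /=; rewrite in_itv.
Qed.

Lemma orth_rot Ph a b : (forall phi, Ph phi -> measurable_fun setT phi) ->
  orth Ph a b -> orth Ph b (\- a).
Proof.
move=> mPh [aa ab H]; split => //; first exact: admN.
move=> phi Pphi; have [H1 H2] := H _ Pphi; split => //.
rewrite (_ : osc _ _ _ = fun y => -1 * osc phi a b y); last first.
  by apply/funext => y; rewrite /osc/=; ring.
rewrite RintegralZl// ?H1 ?mulr0//.
exact: (integ_osc (mPh _ Pphi) aa ab).
Qed.

(** Plays the part of analytic continuation in [k]. For [k0] in [J], [e^(-i k s)] is [e^(-i k0 s)]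
    times [cos ((k - k0) s) - i sin ((k - k0) s)]; openness of [J] makes [s] a multiplier, hence
    also this cosine and sine. *)
Lemma orth_line s (J : set R) k a b : measurable_fun setT s -> bounded_on s ->
  open J -> J !=set0 ->
  orth [set phi | exists2 k, J k & phi = fun y => k * s y] a b ->
  I (osc (fun y => k * s y) a b) = 0.
Proof.
move=> ms bs oJ [k0 Jk0]; set Ph := [set _ | _] => oab.
have mPh phi : Ph phi -> measurable_fun setT phi.
  by move=> [j _ ->]; exact: measurable_funM.
have Ms : multiplier Ph s.
  apply: multiplier_dir => // phi [j Jj ->].
  have /nbhs_ballP[e /= e0 He] : nbhs j J by exact: open_nbhs_nbhs.
  exists e => // t te; exists (j + t); last by apply/funext => y; ring.
  by apply: He; rewrite /ball/= opprD addrA subrr sub0r normrN.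
have Mks : multiplier Ph (fun y => (k - k0) * s y).
  exact: (multiplierM (multiplier_cst (k - k0) mPh) Ms).
have [_ _ /(_ _ _ oab) oc] := multiplier_cos mPh Mks.
have [_ _ /(_ _ _ oab) os] := multiplier_sin mPh Mks.
have P0 : Ph (fun y => k0 * s y) by exists k0.
have [ac1 ac2 /(_ _ P0)[c1 _]] := oc; have [as1 as2 /(_ _ P0)[_ s2]] := os.
have -> : osc (fun y => k * s y) a b =
  osc (fun y => k0 * s y) ((cos \o (fun y => (k - k0) * s y)) \* a)
                          ((cos \o (fun y => (k - k0) * s y)) \* b) \+
  osc (fun y => k0 * s y) ((sin \o (fun y => (k - k0) * s y)) \* b)
                         (\- ((sin \o (fun y => (k - k0) * s y)) \* a)).
  apply/funext => y; rewrite /osc/=.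
  have -> : k * s y = k0 * s y + (k - k0) * s y by ring.
  by rewrite cosD sinD; ring.
rewrite RintegralD// ?c1 ?s2 ?addr0//.
  exact: (integ_osc (mPh _ P0) ac1 ac2).
exact: (integ_osc (mPh _ P0) as2 (admN as1)).
Qed.

End Multipliers.

(* [leb2] lives on [measurableTypeR R * measurableTypeR R], whose display differs
   from the canonical one of [R * R], hence the type annotations below. *)
Lemma multiplier_plane (R : realType)
    (mu : {measure set (measurableTypeR R * measurableTypeR R) -> \bar R})
    (B : set (R * R)) (Ph : set (R * R -> R))
    (E : set (measurableTypeR R * measurableTypeR R)) :
  (forall phi : measurableTypeR R * measurableTypeR R -> R,
     Ph phi -> measurable_fun setT phi) ->
  multiplier mu B Ph fst -> multiplier mu B Ph snd ->
  measurable E -> multiplier mu B Ph \1_E.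
Proof.
move=> mPh M1 M2.
suff : measurable `<=` [set E | measurable E /\ multiplier mu B Ph \1_E].
  by move=> H /H[].
apply: smallest_sub; first exact: multiplier_sigma_algebra.
move=> _ [[A mA <-]|[A mA <-]]; rewrite setTI; split.
- by rewrite -[X in measurable X]setTI; exact: measurable_fst.
- exact: multiplier_preimage.
- by rewrite -[X in measurable X]setTI; exact: measurable_snd.
- exact: multiplier_preimage.
Qed.

(** * Integrability of the sources and phase retrieval *)

Lemma L2_real_integrable (R : realType) (g : pt R -> R) (Om : set (pt R)) M :
  L2_real g -> (forall y, Om y -> `|y.1| <= M /\ `|y.2| <= M) ->
  (forall y, ~ Om y -> g y = 0) -> integ (@leb2 R) g.
Proof.
move=> [mg g2] OmM g0.
pose box := `[- M, M]%classic `*` `[- M, M]%classic : set (pt R).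
have mbox : measurable box by exact: measurableX.
have ibox : integ (@leb2 R) \1_box.
  rewrite /integ (_ : _ \o _ = (cst 1%E) \_ box); last first.
    by apply/funext => r/=; rewrite indic_restrict restrict_EFin.
  apply/integrable_restrict => //=; rewrite setTI.
  apply: measurable_bounded_integrable => //=; last exact: bounded_cst.
  rewrite /leb2 product_measure1E//= !lebesgue_measure_itv/=.
  by case: ifP => _; rewrite ?mule0// -EFinM ltry.
have ig2 : integ (@leb2 R) (fun y => g y ^+ 2).
  apply/integrableP; split.
    by apply/measurable_EFinP; exact: measurable_funX.
  by under eq_integral do rewrite /= ger0_norm ?sqr_ge0//.
(* On the support [|g| <= 1 + g ^+ 2], and the constant 1 is integrable over the bounded box. *)
apply: (le_integ _ _ (integD ibox ig2)) => // y /=.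
have [Oy|Oy] := pselect (Om y); last by rewrite g0// normr0.
have -> : \1_box y = 1 :> R.
  rewrite indicE mem_set// /box /=; have [] := OmM _ Oy.
  by rewrite !ler_norml !in_itv.
rewrite [leRHS]ger0_norm; last by rewrite addr_ge0// sqr_ge0.
rewrite -[X in _ + X]real_normK ?num_real//.
by have := sqr_ge0 (`|g y| - 1); have := normr_ge0 (g y); nra.
Qed.

Lemma normc_eq_sqr (R : realType) (u v : R[i]) : `|u| = `|v| ->
  complex.Re u ^+ 2 + complex.Im u ^+ 2 = complex.Re v ^+ 2 + complex.Im v ^+ 2.
Proof.
rewrite !normc_def => -[] /(congr1 (fun x => x ^+ 2)).
by rewrite !sqr_sqrtr// addr_ge0// sqr_ge0.
Qed.

(** Expanding the squares and cancelling [|U|^2 = |V|^2] leaves [Re (e^(-i th) (P + i Q)) = 0] at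
    both angles, where [P + i Q] is [tau] times the conjugate of [U - V]. The determinant of this
    system in [(P, Q)] is [sin (th0 - th1)] up to sign. *)
Lemma phase_retrieval (R : realType) (tau U V : R[i]) (w th0 th1 : R) :
  tau != 0 -> w != 0 -> sin (th0 - th1) != 0 -> `|U| = `|V| ->
  `|U + tau * expmi th0 * w%:C%C| = `|V + tau * expmi th0 * w%:C%C| ->
  `|U + tau * expmi th1 * w%:C%C| = `|V + tau * expmi th1 * w%:C%C| ->
  U = V.
Proof.
case: tau => tr ti; case: U => ur ui; case: V => vr vi.
move=> t0 w0 s0 /normc_eq_sqr/= e /normc_eq_sqr/= e0 /normc_eq_sqr/= e1.
pose P := tr * (ur - vr) + ti * (ui - vi).
pose Q := ti * (ur - vr) - tr * (ui - vi).
have E0 : cos th0 * P + sin th0 * Q = 0.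
  by apply: (mulfI w0); rewrite mulr0 /P /Q; lra.
have E1 : cos th1 * P + sin th1 * Q = 0.
  by apply: (mulfI w0); rewrite mulr0 /P /Q; lra.
have P0 : P = 0.
  apply: (mulfI s0); rewrite mulr0 sinB.
  rewrite (_ : _ * P = sin th0 * (cos th1 * P + sin th1 * Q)
    - sin th1 * (cos th0 * P + sin th0 * Q)); last by ring.
  by rewrite E0 E1 !mulr0 subr0.
have Q0 : Q = 0.
  apply: (mulfI s0); rewrite mulr0 sinB.
  rewrite (_ : _ * Q = cos th1 * (cos th0 * P + sin th0 * Q)
    - cos th0 * (cos th1 * P + sin th1 * Q)); last by ring.
  by rewrite E0 E1 !mulr0 subr0.
have n0 : tr ^+ 2 + ti ^+ 2 != 0.
  rewrite paddr_eq0 ?sqr_ge0// !sqrf_eq0; apply: contra t0 => /andP[/eqP-> /eqP->].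
  exact/eqP.
have /eqP : ur - vr = 0.
  apply: (mulfI n0); rewrite mulr0 (_ : _ * _ = tr * P + ti * Q).
    by rewrite P0 Q0 !mulr0 addr0.
  by rewrite /P /Q; ring.
have /eqP : ui - vi = 0.
  apply: (mulfI n0); rewrite mulr0 (_ : _ * _ = ti * P - tr * Q).
    by rewrite P0 Q0 !mulr0 subr0.
  by rewrite /P /Q; ring.
by rewrite !subr_eq0 => /eqP -> /eqP ->.
Qed.

(** If the sine vanishes at the midpoint, the cosine there is 1 or -1, and a shift by [h] with
    [0 < h |de| <= 1] makes the sine nonzero; [h <= (hi - lo) / 4] keeps the point inside. *)
Lemma sin_neq0_itv (R : realType) (lo hi de : R) : lo < hi -> de != 0 ->
  exists2 k, lo < k < hi & sin (k * de) != 0.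
Proof.
move=> lh d0; pose k := (lo + hi) / 2.
have [s0|] := eqVneq (sin (k * de)) 0; last by exists k => //; rewrite /k; lra.
have n0 : 0 < `|de| by rewrite normr_gt0.
pose h := Num.min ((hi - lo) / 4) (1 / `|de|).
have h0 : 0 < h by rewrite lt_min !divr_gt0// subr_gt0.
have hle : h <= (hi - lo) / 4 by rewrite ge_min lexx.
have hd : h * `|de| <= 1 by rewrite -ler_pdivlMr// ge_min lexx orbT.
exists (k + h); first by rewrite /k; lra.
rewrite mulrDl sinD s0 mul0r add0r mulf_neq0//.
  by rewrite -normr_eq0 (sin0cos1 s0) oner_eq0.
rewrite -normr_eq0 -[h * de]mulr1 .
have hp : 0 < h * `|de| by rewrite mulr_gt0.
have : sin (h * `|de|) != 0.
  by rewrite gt_eqF// sin2_gt0// hp/= (le_lt_trans hd)// ltr1n.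
rewrite mulr1 normr_eq0; case: (ger0P de) => // _.
by rewrite mulrN sinN oppr_eq0.
Qed.

(** * Far fields as Fourier integrals of the difference of two sources *)

Section FarField.
Variable R : realType.
Implicit Types (F G : pt R -> R[i] * R[i]) (x v y : pt R).
Local Notation I := (Rintegral (@leb2 R) setT).

(** Covers both wave types: [v = x] gives the pressure field and [v = perp x] the shear field, at
    wave number [k]. *)
Definition far (k : R) x v F : R[i] :=
  cint (fun y => expmi (k * dot x y) * cdot v (F y)).

Definition rre v F y : R := v.1 * complex.Re (F y).1 + v.2 * complex.Re (F y).2.
Definition rim v F y : R := v.1 * complex.Im (F y).1 + v.2 * complex.Im (F y).2.

Lemma farE k x v F : far k x v F =
  (I (osc (fun y => k * dot x y) (rre v F) (rim v F)) +i*
   I (osc (fun y => k * dot x y) (rim v F) (\- (rre v F))))%C.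
Proof.
rewrite /far /cint; set r := Rintegral _ _ _; set i := Rintegral _ _ _.
have -> : r = I (osc (fun y => k * dot x y) (rre v F) (rim v F)).
  congr (Rintegral _ _ _); apply/funext => y.
  by rewrite /osc /= /rre /rim /cdot; case: (F y) => -[? ?] [? ?] /=; ring.
have -> : i = I (osc (fun y => k * dot x y) (rim v F) (\- (rre v F))).
  congr (Rintegral _ _ _); apply/funext => y.
  by rewrite /osc /= /rre /rim /cdot; case: (F y) => -[? ?] [? ?] /=; ring.
by apply/eqP; rewrite eq_complex/=; apply/andP; split; apply/eqP; ring.
Qed.

Lemma measurable_dot x : measurable_fun setT
  (dot x : measurableTypeR R * measurableTypeR R -> R).
Proof.
apply: measurable_funD; exact: measurable_funM.
Qed.

Lemma L2_field_adm Om v F : bounded_domain Om -> L2_field F -> supported_in F Om ->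
  adm (@leb2 R) Om (rre v F) /\ adm (@leb2 R) Om (rim v F).
Proof.
move=> [_ _ _ [M OmM]] [r1 i1 r2 i2] sF.
have s0 (h : R[i] * R[i] -> R) y : h (0, 0) = 0 -> ~ Om y -> h (F y) = 0.
  by move=> h0 /sF ->.
have I1 := L2_real_integrable r1 OmM (fun y => @s0 (fun c => complex.Re c.1) y erefl).
have I2 := L2_real_integrable i1 OmM (fun y => @s0 (fun c => complex.Im c.1) y erefl).
have I3 := L2_real_integrable r2 OmM (fun y => @s0 (fun c => complex.Re c.2) y erefl).
have I4 := L2_real_integrable i2 OmM (fun y => @s0 (fun c => complex.Im c.2) y erefl).
split; (split; first by apply: integD; exact: integZ).
  by move=> y Oy; rewrite /rre sF//= !mulr0 addr0.
by move=> y Oy; rewrite /rim sF//= !mulr0 addr0.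
Qed.

Lemma bounded_on_dot Om x : bounded_domain Om -> bounded_on Om (dot x).
Proof.
move=> [_ _ _ [M OmM]]; exists (`|x.1| * M + `|x.2| * M) => y /OmM[h1 h2].
by rewrite (le_trans (ler_normD _ _))// !normrM lerD// ler_wpM2l.
Qed.

Variables (Om : set (pt R)) (F G : pt R -> R[i] * R[i]).
Hypotheses (bOm : bounded_domain Om) (LF : L2_field F) (sF : supported_in F Om)
  (LG : L2_field G) (sG : supported_in G Om).

(** [A v + i B v] is the component of [F - G] along [v]. *)
Let A v := rre v F \- rre v G.
Let B v := rim v F \- rim v G.

Let admA v : adm (@leb2 R) Om (A v).
Proof.
by apply: admD; [|apply: admN]; [have [] := L2_field_adm v bOm LF sF|
  have [] := L2_field_adm v bOm LG sG].
Qed.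

Let admB v : adm (@leb2 R) Om (B v).
Proof.
by apply: admD; [|apply: admN]; [have [] := L2_field_adm v bOm LF sF|
  have [] := L2_field_adm v bOm LG sG].
Qed.

Lemma far_eq_osc k x v : far k x v F = far k x v G ->
  I (osc (fun y => k * dot x y) (A v) (B v)) = 0 /\
  I (osc (fun y => k * dot x y) (B v) (\- (A v))) = 0.
Proof.
rewrite !farE => -[h1 h2].
have mk : measurable_fun setT
      (fun y : measurableTypeR R * measurableTypeR R => k * dot x y).
  by apply: measurable_funM => //; exact: measurable_dot.
have [aF bF] := L2_field_adm v bOm LF sF; have [aG bG] := L2_field_adm v bOm LG sG.
split.
  rewrite (_ : osc _ _ _ = fun y => osc (fun y => k * dot x y) (rre v F) (rim v F) y -
      osc (fun y => k * dot x y) (rre v G) (rim v G) y); last first.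
    by apply/funext => y; rewrite /osc /A /B/=; ring.
  rewrite RintegralB ?h1 ?subrr//.
    exact: (integ_osc mk aF bF).
  exact: (integ_osc mk aG bG).
rewrite (_ : osc _ _ _ = fun y => osc (fun y => k * dot x y) (rim v F) (\- rre v F) y -
    osc (fun y => k * dot x y) (rim v G) (\- rre v G) y); last first.
  by apply/funext => y; rewrite /osc /A /B/=; ring.
rewrite RintegralB ?h2 ?subrr//.
  exact: (integ_osc mk bF (admN aF)).
exact: (integ_osc mk bG (admN aG)).
Qed.

Lemma phaseless_line (tau : R[i]) (z0 z1 x v : pt R) (w sc wmin wmax k : R) :
  tau != 0 -> w != 0 -> 0 < sc -> wmin < wmax -> dot x z0 - dot x z1 != 0 ->
  (forall om, wmin < om < wmax ->
    [/\ `|far (om / sc) x v F| = `|far (om / sc) x v G|,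
    `|far (om / sc) x v F + tau * expmi (om / sc * dot x z0) * w%:C%C| =
    `|far (om / sc) x v G + tau * expmi (om / sc * dot x z0) * w%:C%C| &
    `|far (om / sc) x v F + tau * expmi (om / sc * dot x z1) * w%:C%C| =
    `|far (om / sc) x v G + tau * expmi (om / sc * dot x z1) * w%:C%C|]) ->
  I (osc (fun y => k * dot x y) (A v) (B v)) = 0 /\
  I (osc (fun y => k * dot x y) (B v) (\- (A v))) = 0.
Proof.
move=> tau0 w0 sc0 wW; set de := _ - _ => de0 H.
(* Wave numbers [k = om / sc] of the band at which the phases of the two point sources give
   independent equations. *)
pose J := [set k : R | wmin < k * sc < wmax /\ sin (k * de) != 0].
have oJ : open J.
  have -> : J = (fun k => k * sc) @^-1` `]wmin, wmax[ `&`
      (fun k => sin (k * de)) @^-1` [set t | t != 0].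
    by apply/seteqP; split => t; rewrite /J /= in_itv.
  apply: openI; apply: open_comp.
  - by move=> t _; apply: cvgMl; exact: cvg_id.
  - exact: interval_open.
  - move=> t _; apply: continuous_comp; last exact: continuous_sin.
    by apply: cvgMl; exact: cvg_id.
  - exact: open_neq.
have [k0 k0w k0s] : exists2 k, wmin / sc < k < wmax / sc & sin (k * de) != 0.
  by apply: sin_neq0_itv => //; rewrite ltr_pM2r ?invr_gt0.
have Jn0 : J !=set0.
  move: k0w => /andP[k1 k2]; exists k0; split => //.
  by rewrite -(ltr_pdivrMr _ _ sc0) k1 -(ltr_pdivlMr _ _ sc0).
set Ph := [set phi | exists2 k, J k & phi = fun y : pt R => k * dot x y].
have mPh (phi : measurableTypeR R * measurableTypeR R -> R) : Ph phi -> measurable_fun setT phi.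
  by move=> [j _ ->]; apply: measurable_funM => //; exact: measurable_dot.
have o : orth (@leb2 R) Om Ph (A v) (B v).
  split => // phi [j [jw js] ->]; apply: far_eq_osc.
  have [h h0 h1] := H _ jw.
  move: h h0 h1; rewrite mulfK ?gt_eqF//; apply: phase_retrieval => //.
  by rewrite -mulrBr.
have ms := measurable_dot x; have bs := bounded_on_dot x bOm.
split; first exact: (orth_line k ms bs oJ Jn0 o).
exact: (orth_line k ms bs oJ Jn0 (orth_rot mPh o)).
Qed.

(** For a unit vector [x], the pair [x], [perp x] is an orthonormal basis, so the component along
    any [v] is a combination of the longitudinal and transverse ones. *)
Lemma frame_osc (phi : measurableTypeR R * measurableTypeR R -> R) x v :
  measurable_fun setT phi -> unit_circle x ->
  I (osc phi (A x) (B x)) = 0 -> I (osc phi (A (perp x)) (B (perp x))) = 0 ->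
  I (osc phi (A v) (B v)) = 0.
Proof.
move=> mphi x1 hx hp.
have -> : osc phi (A v) (B v) = fun y => dot v x * osc phi (A x) (B x) y +
    dot v (perp x) * osc phi (A (perp x)) (B (perp x)) y.
  apply/funext => y; rewrite /osc /A /B /rre /rim /dot /perp /=.
  rewrite -[LHS]mul1r -x1; ring.
rewrite RintegralD ?RintegralZl ?hx ?hp ?mulr0 ?addr0//.
- exact: (integ_osc mphi (admA _) (admB _)).
- exact: (integ_osc mphi (admA _) (admB _)).
- exact: (integZ _ (integ_osc mphi (admA _) (admB _))).
- exact: (integZ _ (integ_osc mphi (admA _) (admB _))).
Qed.

Lemma frame_oscN (phi : measurableTypeR R * measurableTypeR R -> R) x v :
  measurable_fun setT phi -> unit_circle x ->
  I (osc phi (B x) (\- A x)) = 0 -> I (osc phi (B (perp x)) (\- A (perp x))) = 0 ->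
  I (osc phi (B v) (\- A v)) = 0.
Proof.
move=> mphi x1 hx hp.
have -> : osc phi (B v) (\- A v) = fun y => dot v x * osc phi (B x) (\- A x) y +
    dot v (perp x) * osc phi (B (perp x)) (\- A (perp x)) y.
  apply/funext => y; rewrite /osc /A /B /rre /rim /dot /perp /=.
  rewrite -[LHS]mul1r -x1; ring.
rewrite RintegralD ?RintegralZl ?hx ?hp ?mulr0 ?addr0//.
- exact: (integ_osc mphi (admB _) (admN (admA _))).
- exact: (integ_osc mphi (admB _) (admN (admA _))).
- exact: (integZ _ (integ_osc mphi (admB _) (admN (admA _)))).
- exact: (integZ _ (integ_osc mphi (admB _) (admN (admA _)))).
Qed.

(** Openness of [Cn] allows the phase [dot xi] to be moved in both coordinate directions, which
    makes [fst] and [snd] multipliers; all Borel indicators follow. *)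
Lemma fourier_unique (Cn : set (pt R)) : open Cn -> Cn !=set0 ->
  (forall xi v, Cn xi -> I (osc (dot xi) (A v) (B v)) = 0 /\
     I (osc (dot xi) (B v) (\- A v)) = 0) ->
  {ae @leb2 R, forall y, F y = G y}.
Proof.
move=> oC [xi0 Cxi0] H.
pose Ph := [set phi : pt R -> R | exists2 xi, Cn xi & phi = dot xi].
have mPh (phi : measurableTypeR R * measurableTypeR R -> R) : Ph phi -> measurable_fun setT phi.
  by move=> [xi _ ->]; exact: measurable_dot.
have o v : orth (@leb2 R) Om Ph (A v) (B v).
  by split => // phi [xi Cxi ->]; exact: H.
have [_ _ _ [M OmM]] := bOm.
have M1 : multiplier (@leb2 R) Om Ph fst.
  refine (@multiplier_dir _ _ _ (@leb2 R) Om Ph _ mPh _ _ _) => //.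
    by exists M => y /OmM[].
  move=> phi [xi Cxi ->].
  have /nbhs_ballP[e /= e0 He] : nbhs xi Cn by exact: open_nbhs_nbhs.
  exists e => // t te; exists (xi.1 + t, xi.2).
    apply: He; split => /=; last exact: ballxx.
    by rewrite /ball/= opprD addrA subrr sub0r normrN.
  by apply/funext => y; rewrite /dot/=; ring.
have M2 : multiplier (@leb2 R) Om Ph snd.
  refine (@multiplier_dir _ _ _ (@leb2 R) Om Ph _ mPh _ _ _) => //.
    by exists M => y /OmM[].
  move=> phi [xi Cxi ->].
  have /nbhs_ballP[e /= e0 He] : nbhs xi Cn by exact: open_nbhs_nbhs.
  exists e => // t te; exists (xi.1, xi.2 + t).
    apply: He; split => /=; first exact: ballxx.
    by rewrite /ball/= opprD addrA subrr sub0r normrN.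
  by apply/funext => y; rewrite /dot/=; ring.
have ME E : measurable E -> multiplier (@leb2 R) Om Ph \1_E.
  exact: multiplier_plane.
have P0 : Ph (dot xi0) by exists xi0.
(* The directions [(1, 0)] and [(0, 1)] isolate the two components of [F - G]. *)
have a1 := @orth_ae_eq0 _ _ _ (@leb2 R) Om Ph _ _ _ P0 (mPh _ P0) ME (o (1, 0)).
have a2 := @orth_ae_eq0 _ _ _ (@leb2 R) Om Ph _ _ _ P0 (mPh _ P0) ME (o (0, 1)).
apply: (filterS2 _ _ a1 a2) => y; rewrite /A /B /rre /rim /= !mul1r !mul0r !addr0 !add0r.
case: (F y) (G y) => -[f1 g1] [f2 g2] [[f1' g1'] [f2' g2']] /=.
by move=> [/eqP + /eqP +] [/eqP + /eqP]; rewrite !subr_eq0 => /eqP -> /eqP -> /eqP -> /eqP ->.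
Qed.

End FarField.

(** * Geometry of the directions common to both arcs *)

Section Cone.
Variable R : realType.
Implicit Types p q xi z : pt R.

Lemma continuous_dot p : continuous (fun xi : pt R => dot p xi).
Proof.
move=> xi; apply: cvgD.
  by apply: cvgMr; exact: cvg_fst.
by apply: cvgMr; exact: cvg_snd.
Qed.

(** The adjoint of the anticlockwise quarter turn is the clockwise one; this form shows continuity
    in [xi]. *)
Lemma dot_perp q xi : dot q (perp xi) = dot (q.2, - q.1) xi.
Proof. by rewrite /dot /perp /=; ring. Qed.

(* The directions at angle in (-60, -30) degrees from [q], where both data sets
   are available, minus the line on which the two point sources have the same phase. *)
Definition cone q z0 z1 : set (pt R) := [set xi | [/\ 0 < dot q xi,
  0 < dot q (perp xi), dot q (perp xi) ^+ 2 < 3 * dot q xi ^+ 2,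
  dot q xi ^+ 2 < 3 * dot q (perp xi) ^+ 2 & dot xi z0 - dot xi z1 != 0]].

Lemma open_cone q z0 z1 : open (cone q z0 z1).
Proof.
pose dz : pt R := (z0.1 - z1.1, z0.2 - z1.2).
pose u := dot q; pose v := dot (q.2, - q.1).
have cu : continuous (u : pt R -> R) by exact: continuous_dot.
have cv : continuous (v : pt R -> R) by exact: continuous_dot.
have copen (g : pt R -> R) : continuous g -> open [set xi | 0 < g xi].
  by move=> cg; apply: (@open_comp _ _ g [set t | 0 < t]) => //; exact: open_gt.
have -> : cone q z0 z1 = [set xi | 0 < u xi] `&` ([set xi | 0 < v xi] `&`
    ([set xi | 0 < 3 * (u xi * u xi) - v xi * v xi] `&`
    ([set xi | 0 < 3 * (v xi * v xi) - u xi * u xi] `&`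
     [set xi | dot dz xi != 0]))).
  apply/seteqP; split => xi; rewrite /cone/= dot_perp -/(u xi) -/(v xi) !subr_gt0.
    move=> [h1 h2 h3 h4 h5]; do ![split => //]; apply: contra_neq h5.
    by rewrite /dot/= => h; rewrite -h; ring.
  move=> [h1 [h2 [h3 [h4 h5]]]]; split => //; apply: contra_neq h5.
  by rewrite /dot/= => h; rewrite -h; ring.
do 2 (apply: openI; first exact: copen).
apply: openI.
  apply: copen => xi; apply: cvgB; last by apply: cvgM; exact: cv.
  by apply: cvgMr; apply: cvgM; exact: cu.
apply: openI.
  apply: copen => xi; apply: cvgB; last by apply: cvgM; exact: cu.
  by apply: cvgMr; apply: cvgM; exact: cv.
apply: (@open_comp _ _ (dot dz : pt R -> R) [set t | t != 0]); last exact: open_neq.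
by move=> xi _; exact: continuous_dot.
Qed.

Lemma cone_neq0 q z0 z1 : unit_circle q -> z0 != z1 -> cone q z0 z1 !=set0.
Proof.
case: q => q1 q2; rewrite /unit_circle/= => q0 z01.
(* [q] plus [t] times its clockwise quarter turn: the quadratic conditions become [1/3 < t^2 < 3],
   met by 1 and [3/2]. Were both vectors orthogonal to [z0 - z1], their independence would give
   [z0 = z1]. *)
pose xi t : pt R := (q1 + t * q2, q2 - t * q1).
have u t : dot (q1, q2) (xi t) = 1 by rewrite /dot/= -q0; ring.
have v t : dot (q1, q2) (perp (xi t)) = t.
  by rewrite /dot/perp/= -[RHS]mulr1 -q0; ring.
pose D t := dot (xi t) z0 - dot (xi t) z1.
have [D1|D1] := eqVneq (D 1) 0; last first.
  by exists (xi 1); split; rewrite ?u ?v//; lra.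
have [D2|D2] := eqVneq (D (3 / 2)) 0; last first.
  by exists (xi (3 / 2)); split; rewrite ?u ?v//; lra.
exfalso; move/eqP: z01; apply.
move: D1 D2; rewrite /D /xi /dot /=.
case: z0 z1 {D} => a b [a' b'] /= D1 D2.
have e1 : q1 * (a - a') + q2 * (b - b') = 0 by lra.
have e2 : q2 * (a - a') - q1 * (b - b') = 0 by lra.
have : (a - a') = 0.
  rewrite -[LHS]mul1r -q0.
  rewrite (_ : _ * _ = q1 * (q1 * (a - a') + q2 * (b - b')) +
    q2 * (q2 * (a - a') - q1 * (b - b'))); last by ring.
  by rewrite e1 e2 !mulr0 addr0.
have : (b - b') = 0.
  rewrite -[LHS]mul1r -q0.
  rewrite (_ : _ * _ = q2 * (q1 * (a - a') + q2 * (b - b')) -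
    q1 * (q2 * (a - a') - q1 * (b - b'))); last by ring.
  by rewrite e1 e2 !mulr0 subr0.
by move=> /eqP + /eqP; rewrite !subr_eq0 => /eqP -> /eqP ->.
Qed.

Lemma cone_direction q z0 z1 xi : unit_circle q -> cone q z0 z1 xi ->
  exists r x, [/\ S_q q x, S_q_perp q x, dot x z0 - dot x z1 != 0 &
    dot xi = fun y => r * dot x y].
Proof.
move=> q0 [h1 h2 h3 h4 h5].
have n2 : xi.1 ^+ 2 + xi.2 ^+ 2 = dot q xi ^+ 2 + dot q (perp xi) ^+ 2.
  by rewrite -[LHS]mul1r -q0 /dot/perp/=; ring.
pose r := Num.sqrt (xi.1 ^+ 2 + xi.2 ^+ 2).
have r0 : 0 < r by rewrite sqrtr_gt0 n2 addr_gt0// exprn_gt0.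
have r2 : r ^+ 2 = xi.1 ^+ 2 + xi.2 ^+ 2 by rewrite sqr_sqrtr// addr_ge0// sqr_ge0.
have rn0 : r != 0 by rewrite gt_eqF.
(* With [u] and [v] the products of [q] with [xi] and [perp xi], [r^2 = u^2 + v^2]; thus
   [v^2 < 3 u^2] reads [r^2 < 4 u^2], the arc condition after normalisation. The same holds with [u]
   and [v] exchanged. *)
have half u : 0 < u -> r ^+ 2 < 4 * u ^+ 2 -> 1 / 2 <= u / r.
  move=> u0 ur; rewrite ler_pdivlMr//.
  suff : r < 2 * u by lra.
  by rewrite -(ltr_pXn2r (n := 2)) ?nnegrE ?(ltW r0)//; [lra|lra].
exists r, (xi.1 / r, xi.2 / r).
have ux : unit_circle (xi.1 / r, xi.2 / r).
  by rewrite /unit_circle/= !expr_div_n -mulrDl -r2 divff// expf_neq0.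
split.
- split => //; rewrite (_ : dot _ _ = dot q xi / r); last by rewrite /dot/=; ring.
  by apply: half => //; rewrite r2 n2; lra.
- split => //.
  rewrite (_ : dot _ _ = dot q (perp xi) / r); last by rewrite /dot/perp/=; ring.
  by apply: half => //; rewrite r2 n2; lra.
- rewrite (_ : _ - _ = (dot xi z0 - dot xi z1) / r); last by rewrite /dot/=; ring.
  by rewrite mulf_neq0// invr_eq0.
- by apply/funext => y; rewrite /dot/=; field.
Qed.

End Cone.

Theorem theorem3p2 (R : realType) (wmin wmax lam mu : R)
  (Om : set (pt R)) (F G : pt R -> R[i] * R[i])
  (tau1 : R[i]) (z0 z1 q : pt R) :
  0 < wmin -> wmin < wmax -> 0 < mu -> 0 < 2 * mu + lam ->
  bounded_domain Om ->
  L2_field F -> supported_in F Om ->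
  L2_field G -> supported_in G Om ->
  tau1 != 0 -> z0 != z1 -> ~ closure Om z0 -> ~ closure Om z1 ->
  unit_circle q ->
  (forall x omega tau z, S_q q x -> wmin < omega < wmax ->
     tau \in [:: 0; tau1] -> z \in [:: z0; z1] ->
     `|uinf_pz lam mu F z x q omega tau| = `|uinf_pz lam mu G z x q omega tau|) ->
  (forall x omega tau z, S_q_perp q x -> wmin < omega < wmax ->
     tau \in [:: 0; tau1] -> z \in [:: z0; z1] ->
     `|uinf_sz mu F z x q omega tau| = `|uinf_sz mu G z x q omega tau|) ->
  {ae @leb2 R, forall y, F y = G y}.
Proof.
move=> _ wW mu0 lm0 bOm LF sF LG sG tau0 z01 _ _ q0 Hp Hs.
have i0 : (0 : R[i]) \in [:: 0; tau1] by rewrite !inE eqxx.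
have i1 : tau1 \in [:: 0; tau1] by rewrite !inE eqxx orbT.
have j0 : z0 \in [:: z0; z1] by rewrite !inE eqxx.
have j1 : z1 \in [:: z0; z1] by rewrite !inE eqxx orbT.
apply: (fourier_unique bOm LF sF LG sG (@open_cone _ q z0 z1)).
  exact: cone_neq0.
move=> xi v /(cone_direction q0)[r [x [Sx Spx dx ->]]].
have [ux qx] := Sx; have [_ qpx] := Spx.
have wp : dot q x != 0 by rewrite gt_eqF//; lra.
have ws : dot q (perp x) != 0 by rewrite gt_eqF//; lra.
have cp : 0 < Num.sqrt (lam + 2 * mu) by rewrite sqrtr_gt0; lra.
have cs : 0 < Num.sqrt mu by rewrite sqrtr_gt0.
have ep om (hom : wmin < om < wmax) :
    `|uinf_p lam mu F x om| = `|uinf_p lam mu G x om|.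
  by have := Hp x om 0 z0 Sx hom i0 j0; rewrite /uinf_pz !mul0r !addr0.
have es om (hom : wmin < om < wmax) : `|uinf_s mu F x om| = `|uinf_s mu G x om|.
  by have := Hs x om 0 z0 Spx hom i0 j0; rewrite /uinf_sz !mul0r !addr0.
(* The pressure and shear bands of wave numbers differ and may be disjoint. Extending both to the
   common wave number [r] gives the longitudinal and transverse components at the same frequency
   vector [xi = r x]. *)
have [p1 p2] := phaseless_line bOm LF sF LG sG (v := x) r tau0 wp cp wW dx
  (fun om hom => And3 (ep om hom) (Hp _ _ _ _ Sx hom i1 j0)
    (Hp _ _ _ _ Sx hom i1 j1)).
have [s1 s2] := phaseless_line bOm LF sF LG sG (v := perp x) r tau0 ws cs wW dx
  (fun om hom => And3 (es om hom) (Hs _ _ _ _ Spx hom i1 j0)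
    (Hs _ _ _ _ Spx hom i1 j1)).
have mphi : measurable_fun setT
    (fun y : measurableTypeR R * measurableTypeR R => r * dot x y).
  by apply: measurable_funM => //; exact: measurable_dot.
split.
  exact: (frame_osc bOm LF sF LG sG v mphi ux p1 s1).
exact: (frame_oscN bOm LF sF LG sG v mphi ux p2 s2).
Qed.
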